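(* Let $m \ge n$, let $A \in \mathbb{R}^{m\times n}$ have full rank, and let $x \in \mathbb{R}^n$ and $b \in \mathbb{R}^m$ satisfy $Ax = b$. Let $x_k \in \mathbb{R}^n$ be a given iterate and let $x_{k+1}$ be the random vector obtained from $x_k$ by one step of the Randomized Kaczmarz method for $Ax=b$. If $x_k \neq x$ and $\mathbb{P}(x_{k+1} = x)=0$, then $$ \mathbb{E} \left\langle \frac{x_k-x}{\|x_k-x\|}, \frac{x_{k+1}-x}{\|x_{k+1}-x\|} \right\rangle^2 = 1 - \frac{1}{\|A\|_F^2}\left\| A\, \frac{x_k-x}{\|x_k - x\|} \right\|^2 .$$
   Context: Let $a_1,\dots,a_m \in \mathbb{R}^n$ denote the rows of $A$ and $b_1,\dots,b_m$ the entries of $b$. $\|\cdot\|$ is the Euclidean norm, $\langle\cdot,\cdot\rangle$ the standard inner product, and $\|A\|_F$ the Frobenius norm, so $\|A\|_F^2=\sum_{i=1}^m \|a_i\|^2$. One step of the Randomized Kaczmarz method: given $x_k$, choose an index $i \in \{1,\dots,m\}$ at random, where $i$ is chosen with probability $\|a_i\|^2/\|A\|_F^2$, and set $$x_{k+1} = x_k + \frac{b_i - \langle a_i, x_k\rangle}{\|a_i\|^2}\, a_i .$$ (Zero rows, if any, are chosen with probability $0$.) The vector $x_k$ is regarded as fixed: the probability $\mathbb{P}$ and the expectation $\mathbb{E}$ are with respect to the random choice of the index $i$ in this single step. The expectation is of the square of the inner product. *)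

(* Defs.v *)
From mathcomp Require Import all_boot all_order all_algebra.
From mathcomp Require Import all_classical all_reals all_analysis.

Set Implicit Arguments.
Unset Strict Implicit.
Unset Printing Implicit Defensive.

Import Order.TTheory GRing.Theory Num.Theory.

Local Open Scope classical_set_scope.
Local Open Scope ring_scope.

(* The norm `|v| which MathComp-Analysis puts on matrices is the sup norm,
   hence the explicit Euclidean and Frobenius norms below. *)
Definition dotv (R : realType) (n : nat) (u v : 'cV[R]_n) : R :=
  \sum_(j < n) u j 0 * v j 0.

Definition norm2 (R : realType) (n : nat) (v : 'cV[R]_n) : R :=
  Num.sqrt (dotv v v).

Definition normF (R : realType) (m n : nat) (A : 'M[R]_(m, n)) : R :=
  Num.sqrt (\sum_(i < m) \sum_(j < n) A i j ^+ 2).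

(* For v = 0 this is 0, since 0^-1 = 0. *)
Definition normalize (R : realType) (n : nat) (v : 'cV[R]_n) : 'cV[R]_n :=
  (norm2 v)^-1 *: v.

(* The vector a_i, as a column. *)
Definition rowv (R : realType) (m n : nat) (A : 'M[R]_(m, n)) (i : 'I_m) :
    'cV[R]_n :=
  (row i A)^T.

(* For a zero row the quotient is 0 by convention and the step leaves xk
   unchanged; such an index has probability 0 under [kaczmarz_index]. *)
Definition kaczmarz_step (R : realType) (m n : nat) (A : 'M[R]_(m, n))
    (b : 'cV[R]_m) (xk : 'cV[R]_n) (i : 'I_m) : 'cV[R]_n :=
  xk + ((b i 0 - dotv (rowv A i) xk) / norm2 (rowv A i) ^+ 2) *: rowv A i.

(* The first conjunct says that I is a random variable: 'I_m has no
   measurableType structure (it is empty for m = 0), and since it is finite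
   the events {I = i} generate all the events {I \in B}. *)
Definition kaczmarz_index (d : measure_display) (T : measurableType d)
    (R : realType) (P : probability T R) (m n : nat) (A : 'M[R]_(m, n))
    (I : T -> 'I_m) : Prop :=
  (forall i : 'I_m, measurable (I @^-1` [set i])) /\
  (forall i : 'I_m,
     P (I @^-1` [set i]) = (norm2 (rowv A i) ^+ 2 / normF A ^+ 2)%:E).

(* Main.v *)
(* Put u := x_k - x. If row i is chosen then y := x_{k+1} - x is the orthogonal
   projection of u along a_i, so that <u, y> = |y|^2 and the squared cosine of
   the angle between u and y is |y|^2 / |u|^2 = 1 - <a_i, u>^2 / (|a_i|^2 |u|^2).
   Averaging with the weights |a_i|^2 / |A|_F^2 cancels |a_i|^2 and leaves
   1 - |A u|^2 / (|A|_F^2 |u|^2). *)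
Require Import Defs.
From mathcomp Require Import all_boot all_order all_algebra.
From mathcomp Require Import all_classical all_reals all_analysis.
From mathcomp Require Import measurable_realfun ring.

Set Implicit Arguments.
Unset Strict Implicit.
Unset Printing Implicit Defensive.

Import Order.TTheory GRing.Theory Num.Theory.

Local Open Scope classical_set_scope.
Local Open Scope ring_scope.

Section EuclideanSpace.
Context (R : realType) (n : nat).
Implicit Types u v w : 'cV[R]_n.

Lemma dotvC u v : dotv u v = dotv v u.
Proof. by apply: eq_bigr => j _; rewrite mulrC. Qed.

Lemma dotvDl u v w : dotv (u + v) w = dotv u w + dotv v w.
Proof.
by rewrite /dotv -big_split; apply: eq_bigr => j _; rewrite mxE mulrDl.
Qed.

Lemma dotvZl (c : R) u v : dotv (c *: u) v = c * dotv u v.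
Proof. by rewrite /dotv mulr_sumr; apply: eq_bigr => j _; rewrite mxE mulrA. Qed.

Lemma dotvDr u v w : dotv u (v + w) = dotv u v + dotv u w.
Proof. by rewrite dotvC dotvDl !(dotvC u). Qed.

Lemma dotvZr (c : R) u v : dotv u (c *: v) = c * dotv u v.
Proof. by rewrite dotvC dotvZl dotvC. Qed.

Lemma dotvBr u v w : dotv u (v - w) = dotv u v - dotv u w.
Proof. by rewrite -scaleN1r dotvDr dotvZr mulN1r. Qed.

Lemma dotv_ge0 u : 0 <= dotv u u.
Proof. by apply: sumr_ge0 => j _; rewrite -expr2 sqr_ge0. Qed.

Lemma sqr_norm2 u : norm2 u ^+ 2 = dotv u u.
Proof. by rewrite sqr_sqrtr// dotv_ge0. Qed.

Lemma dotv_eq0 u : (dotv u u == 0) = (u == 0).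
Proof.
apply/idP/eqP => [|->]; last first.
  by rewrite /dotv big1// => j _; rewrite mxE mul0r.
rewrite psumr_eq0 => [/allP u0|j _]; last by rewrite -expr2 sqr_ge0.
apply/matrixP => j k; rewrite ord1 mxE.
by have := u0 j (mem_index_enum j); rewrite /= mulf_eq0 orbb => /eqP.
Qed.

Lemma dotv0r u : dotv u 0 = 0.
Proof. by rewrite -(scale0r 0) dotvZr mul0r. Qed.

(** Squaring turns both norms into inner products, so no square root remains. Zero vectors are
    covered because [0^-1 = 0]. *)
Lemma sqr_dotv_normalize u v :
  dotv (normalize u) (normalize v) ^+ 2
  = dotv u v ^+ 2 / (dotv u u * dotv v v).
Proof.
rewrite /normalize dotvZl dotvZr mulrA exprMn exprMn !exprVn !sqr_norm2.
by rewrite invfM mulrC.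
Qed.

(* The projection of u along a; for a = 0 the quotient vanishes and the
   projection is u itself. *)
Lemma sqr_cos_proj u a : u != 0 ->
  dotv (normalize u) (normalize (u - (dotv a u / dotv a a) *: a)) ^+ 2
  = 1 - dotv a u ^+ 2 / dotv a a / dotv u u.
Proof.
move=> u0; have duu : dotv u u != 0 by rewrite dotv_eq0.
set y := u - _.
have duy : dotv u y = dotv u u - dotv a u ^+ 2 / dotv a a.
  by rewrite /y dotvBr dotvZr (dotvC u a) expr2 mulrAC.
have day : dotv a y = 0 \/ dotv a a = 0.
  have [aa0|aa0] := eqVneq (dotv a a) 0; [by right | left].
  by rewrite /y dotvBr dotvZr divfK// subrr.
have dyy : dotv y y = dotv u y.
  rewrite {1}/y -scaleNr dotvDl dotvZl.
  by case: day => ->; rewrite ?invr0 ?mulr0 ?oppr0 ?mul0r addr0.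
rewrite sqr_dotv_normalize dyy.
have -> : 1 - dotv a u ^+ 2 / dotv a a / dotv u u = dotv u y / dotv u u.
  by rewrite duy mulrBl divff.
(* Here [dotv u y] is the squared length of [y]. If it is 0, both sides vanish; otherwise it cancels
   once. *)
have [->|uy0] := eqVneq (dotv u y) 0; first by rewrite expr0n !mul0r.
by field; rewrite duu uy0.
Qed.

End EuclideanSpace.

Section Rows.
Context (R : realType) (m n : nat).
Implicit Types A : 'M[R]_(m, n).

Lemma dotv_rowv A i (v : 'cV[R]_n) : dotv (rowv A i) v = (A *m v) i 0.
Proof. by rewrite mxE; apply: eq_bigr => j _; rewrite !mxE. Qed.

(** For a consistent system the residual of row i is minus the inner product of that row with
    [xk - x], so the step removes from the error its component along the row. *)
Lemma kaczmarz_step_sub A (x xk : 'cV[R]_n) i :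
  kaczmarz_step A (A *m x) xk i - x
  = (xk - x) - (dotv (rowv A i) (xk - x) / dotv (rowv A i) (rowv A i))
               *: rowv A i.
Proof.
rewrite /kaczmarz_step sqr_norm2 -dotv_rowv dotvBr addrAC -scaleNr -mulNr.
by rewrite opprB.
Qed.

End Rows.

Section FiniteRandomVariable.
Context (d : measure_display) (T : measurableType d) (R : realType).
Context (P : probability T R) (K : finType) (I : T -> K).
Context (mI : forall i, measurable (I @^-1` [set i])).

(** [g \o I] is a combination of indicators of the fibres of [I]. Nonnegativity lets sum and
    integral be exchanged without an integrability argument. *)
Lemma ge0_expectation_finite (g : K -> R) : (forall i, 0 <= g i) ->
  ('E_P[g \o I] = \sum_i (g i)%:E * P (I @^-1` [set i]))%E.
Proof.
move=> g0; rewrite unlock.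
have -> : (fun w => (g (I w))%:E)
        = (fun w => \sum_i (g i)%:E * (\1_(I @^-1` [set i]) w)%:E)%E.
  apply/funext => w; rewrite (bigD1 (I w))//= big1 ?adde0 => [|i iw].
    by rewrite indicE mem_set// mule1.
  by rewrite indicE memNset ?mule0// => /= Iwi; rewrite Iwi eqxx in iw.
have mind i : measurable_fun setT (\1_(I @^-1` [set i]) : T -> R).
  exact: measurable_indic.
rewrite ge0_integral_sum//=.
- apply: eq_bigr => i _; rewrite ge0_integralZl_EFin//.
  + by rewrite integral_indic// setIT.
  + exact/measurable_EFinP.
- by move=> i; apply: measurable_funeM; exact/measurable_EFinP.
- by move=> i w _; rewrite mule_ge0// lee_fin.
Qed.

(** The expectation of the constant 1, computed fibre by fibre. *)
Lemma sum_probability_finite : (\sum_i P (I @^-1` [set i]) = 1)%E.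
Proof.
have := ge0_expectation_finite (fun _ => ler01).
rewrite (_ : _ \o I = cst 1)// expectation_cst => ->.
by apply: eq_bigr => i _; rewrite mul1e.
Qed.

End FiniteRandomVariable.

Theorem theorem3 (R : realType) (m n : nat) (hmn : (n <= m)%N)
    (A : 'M[R]_(m, n)) (hA : \rank A = minn m n)
    (x : 'cV[R]_n) (b : 'cV[R]_m) (hAx : A *m x = b)
    (xk : 'cV[R]_n)
    (d : measure_display) (T : measurableType d) (P : probability T R)
    (I : T -> 'I_m) (hI : kaczmarz_index P A I)
    (hxk : xk <> x)
    (hP : P [set w | kaczmarz_step A b xk (I w) = x] = 0%E) :
  ('E_P[fun w : T =>
          (dotv (normalize (xk - x))
                (normalize (kaczmarz_step A b xk (I w) - x)) ^+ 2)%R])%E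
  = (1 - 1 / normF A ^+ 2 * norm2 (A *m normalize (xk - x)) ^+ 2)%:E.
Proof.
case: hI => mI PI; rewrite -{}hAx {hP b}.
set u := xk - x; have u0 : u != 0 by rewrite subr_eq0; apply/eqP.
pose q i := dotv (rowv A i) (rowv A i).
pose c i := dotv (rowv A i) u ^+ 2.
(* The weights are the probabilities of the fibres of [I]. Were [normF A] zero, each quotient would
   be 0 and the total could not be 1, which gives [F0]. *)
have sum1 : \sum_i q i / normF A ^+ 2 = 1.
  apply: EFin_inj; rewrite -(sum_probability_finite P mI) -sumEFin.
  by apply: eq_bigr => i _; rewrite PI sqr_norm2.
have F0 : normF A != 0.
  apply/eqP => F0; move: sum1; rewrite F0 expr0n big1 => [|i _].
    by move/eqP; rewrite eq_sym oner_eq0.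
  by rewrite invr0 mulr0.
rewrite (ge0_expectation_finite P mI (g := fun i =>
    dotv (normalize u) (normalize (kaczmarz_step A (A *m x) xk i - x)) ^+ 2));
  last by move=> i; exact: sqr_ge0.
under eq_bigr do rewrite PI -EFinM kaczmarz_step_sub sqr_cos_proj// sqr_norm2.
rewrite sumEFin; congr EFin.
have -> : norm2 (A *m normalize u) ^+ 2 = (\sum_i c i) / dotv u u.
  rewrite /normalize -scalemxAr sqr_norm2 dotvZl dotvZr mulrA -expr2 exprVn.
  rewrite sqr_norm2 mulrC; congr (_ / _); apply: eq_bigr => i _.
  by rewrite -dotv_rowv.
(* Writing the leading 1 as the sum of the weights reduces the claim to an identity for each row. *)
rewrite -[X in _ = X - _]sum1 mulrA mulr_sumr mulr_suml -sumrB; apply: eq_bigr => i _.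
(* A zero row has weight 0 and [c i = 0], so it contributes 0 to both sides; for the other rows
   [q i] cancels. *)
have [qi0|qi0] := eqVneq (q i) 0.
  have /eqP ai0 : rowv A i == 0 by rewrite -dotv_eq0; apply/eqP.
  by rewrite /q /c ai0 dotvC !dotv0r expr0n !(mul0r, mulr0) subr0.
rewrite -/u -/(q i) -/(c i); field.
by rewrite F0 dotv_eq0 u0 qi0.
Qed.
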